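(* Suppose that $\mathcal{L} = L\mathbb{Z}^{2d} \subseteq \mathbb{R}^{2d}$ is a lattice whose generating matrix has rational entries, $L \in \mathrm{GL}_{2d}(\mathbb{Q})$. Then for every real-valued window function $g \in L^2(\mathbb{R}^d,\mathbb{R})$ there exist two real-valued functions $f_1,f_2 \in L^2(\mathbb{R}^d,\mathbb{R})$ such that $|V_g f_1(z)| = |V_g f_2(z)|$ for all $z \in \mathcal{L}$ and there is no $\nu\in\mathbb{C}$ with $|\nu|=1$ and $f_1=\nu f_2$.
   Context: $V_gf(x,\omega)=\int_{\mathbb{R}^d} f(t)\overline{g(t-x)}e^{-2\pi i \omega\cdot t}\,dt$ is the short-time Fourier transform. $L^2(\mathbb{R}^d,\mathbb{R})$ denotes the real-valued functions in $L^2(\mathbb{R}^d)$. *)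

(* Defs.v *)
From HB Require Import structures.
From mathcomp Require Import all_boot all_order all_algebra.
From mathcomp Require Import all_classical all_reals all_analysis.
From mathcomp Require Import complex.
Set Implicit Arguments. Unset Strict Implicit. Unset Printing Implicit Defensive.
Import Order.TTheory GRing.Theory Num.Theory.
Local Open Scope ring_scope.

(* R^d is modelled as d.-tuple R, equipped with the library's product
   (= Borel) sigma-algebra on tuples (measure_tuple_display). *)

(* Iterated Lebesgue integral over R^d of an extended-real valued function:
   int_{R^d} F = int_R ( ... int_R F(t_1,...,t_d) dt_d ... ) dt_1.
   For nonnegative measurable F this is the Lebesgue integral on R^d (Tonelli). *)
Fixpoint iint (R : realType) (n : nat) : (n.-tuple R -> \bar R) -> \bar R :=
  match n return (n.-tuple R -> \bar R) -> \bar R with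
  | 0 => fun F => F [tuple]
  | n'.+1 => fun F =>
      (\int[@lebesgue_measure R]_(x in [set: R])
          iint (fun t : n'.-tuple R => F (cons_tuple x t)))%E
  end.

Definition Rint (R : realType) (d : nat) (F : d.-tuple R -> R) : \bar R :=
  (iint (fun t => (Num.max (F t) 0)%:E) - iint (fun t => (Num.max (- F t) 0)%:E))%E.

Definition L2R (R : realType) (d : nat) (f : d.-tuple R -> R) : Prop :=
  measurable_fun [set: d.-tuple R] f /\
  (iint (fun t => (f t ^+ 2)%:E) < +oo)%E.

Definition vsub (R : realType) (d : nat) (t x : d.-tuple R) : d.-tuple R :=
  [tuple tnth t i - tnth x i | i < d].

Definition vdot (R : realType) (d : nat) (w t : d.-tuple R) : R :=
  \sum_(i < d) tnth w i * tnth t i.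

(* Short-time Fourier transform V_g f(x, w) = int f(t) conj(g(t-x)) e^{-2 pi i w.t} dt
   for real-valued f and g (so conj(g) = g), written as real part + i imaginary
   part: e^{-2 pi i w.t} = cos(2 pi w.t) - i sin(2 pi w.t). *)
Definition stft (R : realType) (d : nat) (g f : d.-tuple R -> R)
    (x w : d.-tuple R) : R[i] :=
  ((fine (Rint (fun t => f t * g (vsub t x) * cos (2 * pi * vdot w t))))
   +i* (- fine (Rint (fun t => f t * g (vsub t x) * sin (2 * pi * vdot w t)))))%C.

Definition latpt (R : realType) (d : nat) (L : 'M[rat]_(d + d))
    (k : 'cV[int]_(d + d)) : 'cV[R]_(d + d) :=
  map_mx (fun q : rat => ratr q) L *m map_mx (fun n : int => n%:~R) k.

Definition latx (R : realType) (d : nat) (L : 'M[rat]_(d + d))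
    (k : 'cV[int]_(d + d)) : d.-tuple R :=
  [tuple latpt R L k (lshift d i) 0 | i < d].

Definition latw (R : realType) (d : nat) (L : 'M[rat]_(d + d))
    (k : 'cV[int]_(d + d)) : d.-tuple R :=
  [tuple latpt R L k (rshift d i) 0 | i < d].

(* Main.v *)
(* If N x is an integer vector for every time shift x of the lattice and s is an
   odd 1-periodic function of one variable, put
   f1(t) = g(-t) (1 + s(N t_0)) and f2(t) = g(-t) (1 - s(N t_0)).
   Since s(N (x_0 - t_0)) = - s(N t_0), the reflection t -> x - t turns
   f2(t) g(t - x) into f1(t) g(t - x); as these functions are real, their Fourier
   transforms have the same modulus at every frequency.
   If f1 = nu f2 with |nu| = 1, then f1^2 = f2^2, so s(N t_0) g(-t) = 0 a.e.,
   and g = 0 a.e. because s vanishes only on a countable set. When g = 0 a.e.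
   the transform is identically 0 and any two functions of different norms do. *)
Require Import Defs.
From HB Require Import structures.
From mathcomp Require Import all_boot all_order all_algebra.
From mathcomp Require Import all_classical all_reals all_analysis.
From mathcomp Require Import complex.
From mathcomp Require Import measurable_realfun ring lra.
Set Implicit Arguments. Unset Strict Implicit.
Import Order.TTheory GRing.Theory Num.Theory.
Local Open Scope ring_scope.

(** * Iterated integrals of nonnegative functions *)

Lemma iint_ge0 (R : realType) (n : nat) (F : n.-tuple R -> \bar R) :
  (forall t, 0 <= F t)%E -> (0 <= iint F)%E.
Proof.
elim: n F => [|n IH] F F0 /=; first exact: F0.
by apply: integral_ge0 => x _; exact: IH.
Qed.

(** The parameter space [X] is left arbitrary so that the induction can absorb the first coordinate
    into it, passing from [X] to [X * R]. The remaining integration in that coordinate is measurable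
    by the one-variable Tonelli theorem. *)
Lemma measurable_iint_section (R : realType) (dX : measure_display)
    (X : measurableType dX) (n : nat) (F : X * n.-tuple R -> \bar R) :
  measurable_fun setT F -> (forall z, (0 <= F z)%E) ->
  measurable_fun setT (fun x => iint (fun t => F (x, t))).
Proof.
elim: n dX X F => [|n IH] dX X F mF F0 /=.
  apply: (measurableT_comp mF).
  exact: measurable_fun_pair.
have mG : measurable_fun setT
    (fun z : X * R => iint (fun t => F (z.1, cons_tuple z.2 t))).
  apply: (IH _ (X * R)%type
            (fun u => F (u.1.1, cons_tuple u.1.2 u.2))) => //.
  apply: (measurableT_comp mF).
  apply: measurable_fun_pair => /=.
    exact: (measurableT_comp measurable_fst measurable_fst).
  apply: measurable_cons => //.
  exact: (measurableT_comp measurable_snd measurable_fst).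
apply: (measurable_fun_fubini_tonelli_F (m2 := lebesgue_measure) _ mG) => /= z.
exact: iint_ge0.
Qed.

Lemma measurable_cons_tuple (R : realType) (n : nat) (x : R) :
  measurable_fun setT (fun t : n.-tuple R => cons_tuple x t).
Proof. exact: measurable_cons. Qed.

Lemma measurable_cons_section (R : realType) (n : nat) (d : measure_display)
    (V : measurableType d) (F : n.+1.-tuple R -> V) (x : R) :
  measurable_fun setT F -> measurable_fun setT (fun t => F (cons_tuple x t)).
Proof. by move=> mF; apply: (measurableT_comp mF); exact: measurable_cons_tuple. Qed.

Lemma measurable_iint_cons (R : realType) (n : nat)
    (F : n.+1.-tuple R -> \bar R) :
  measurable_fun setT F -> (forall t, 0 <= F t)%E ->
  measurable_fun setT (fun x : R => iint (fun t => F (cons_tuple x t))).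
Proof.
move=> mF F0.
apply: (@measurable_iint_section R _ R n
          (fun z => F (cons_tuple z.1 z.2))) => //.
by apply: (measurableT_comp mF); exact: measurable_cons.
Qed.

Lemma iintD (R : realType) (n : nat) (F G : n.-tuple R -> \bar R) :
  measurable_fun setT F -> (forall t, 0 <= F t)%E ->
  measurable_fun setT G -> (forall t, 0 <= G t)%E ->
  iint (fun t => F t + G t)%E = (iint F + iint G)%E.
Proof.
elim: n F G => [|n IH] F G mF F0 mG G0 //=.
rewrite -ge0_integralD//.
- apply: eq_integral => x _.
  by apply: IH => //; exact: measurable_cons_section.
- by move=> x _; exact: iint_ge0.
- exact: measurable_iint_cons.
- by move=> x _; exact: iint_ge0.
- exact: measurable_iint_cons.
Qed.

Lemma iintZ (R : realType) (n : nat) (k : R) (F : n.-tuple R -> \bar R) :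
  0 <= k -> measurable_fun setT F -> (forall t, 0 <= F t)%E ->
  iint (fun t => k%:E * F t)%E = (k%:E * iint F)%E.
Proof.
move=> k0; elim: n F => [|n IH] F mF F0 //=.
rewrite -ge0_integralZl//.
- apply: eq_integral => x _.
  by apply: IH => //; exact: measurable_cons_section.
- exact: measurable_iint_cons.
- by move=> x _; exact: iint_ge0.
Qed.

Lemma le_iint (R : realType) (n : nat) (F G : n.-tuple R -> \bar R) :
  measurable_fun setT F -> (forall t, 0 <= F t)%E -> measurable_fun setT G ->
  (forall t, F t <= G t)%E -> (iint F <= iint G)%E.
Proof.
elim: n F G => [|n IH] F G mF F0 mG FG //=.
have G0 t : (0 <= G t)%E by exact: le_trans (FG t).
apply: ge0_le_integral => //.
- by move=> x _; exact: iint_ge0.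
- exact: measurable_iint_cons.
- exact: measurable_iint_cons.
- by move=> x _; apply: IH => //; exact: measurable_cons_section.
Qed.


(** * Almost-everywhere arguments *)

Lemma ae_lebesgueS (R : realType) (P Q : R -> Prop) :
  (forall x, P x -> Q x) -> {ae @lebesgue_measure R, forall x, P x} ->
  {ae @lebesgue_measure R, forall x, Q x}.
Proof. by apply: filterS; exact: (ae_filter_ringOfSetsType lebesgue_measure). Qed.

Lemma ae_lebesgueS2 (R : realType) (P Q S : R -> Prop) :
  (forall x, P x -> Q x -> S x) -> {ae @lebesgue_measure R, forall x, P x} ->
  {ae @lebesgue_measure R, forall x, Q x} ->
  {ae @lebesgue_measure R, forall x, S x}.
Proof. by apply: filterS2; exact: (ae_filter_ringOfSetsType lebesgue_measure). Qed.

Lemma ge0_integral_eq0P (R : realType) (F : R -> \bar R) :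
  measurable_fun setT F -> (forall x, 0 <= F x)%E ->
  (\int[@lebesgue_measure R]_x F x = 0)%E <->
  {ae @lebesgue_measure R, forall x, F x = 0%E}.
Proof.
move=> mF F0.
have absF : (\int[@lebesgue_measure R]_x `|F x| = \int[@lebesgue_measure R]_x F x)%E.
  by apply: eq_integral => x _; rewrite gee0_abs.
have aeF := @ae_eq_integral_abs _ _ R lebesgue_measure setT measurableT F mF.
rewrite -absF; split=> [/(proj1 aeF)|F_ae0]; first by apply: ae_lebesgueS => x; exact.
by apply/(proj2 aeF); apply: ae_lebesgueS F_ae0.
Qed.

(** This plays the part of almost-everywhere reasoning in several variables. A nonnegative iterated
    integral vanishes exactly when the inner one vanishes for almost every first coordinate, so
    inclusion of zero sets is carried through one coordinate at a time. *)
Lemma iint_eq0_sub (R : realType) (n : nat) (F G : n.-tuple R -> \bar R) :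
  measurable_fun setT F -> (forall t, 0 <= F t)%E ->
  measurable_fun setT G -> (forall t, 0 <= G t)%E ->
  (forall t, F t = 0 -> G t = 0)%E -> iint F = 0%E -> iint G = 0%E.
Proof.
elim: n F G => [|n IH] F G mF F0 mG G0 FG /=; first exact: FG.
move/ge0_integral_eq0P => iF; apply/ge0_integral_eq0P.
- exact: measurable_iint_cons.
- by move=> x; exact: iint_ge0.
apply: (@ae_lebesgueS _ _ _ _ (iF _ _)) => [x||x]; last exact: iint_ge0.
  by apply: IH => //; [exact: measurable_cons_section..|move=> t; exact: FG].
exact: measurable_iint_cons.
Qed.

(** * Invariance under reflections and translations *)

(** By uniqueness of Lebesgue measure it suffices to test half-open intervals; reflection exchanges
    the open and closed ends and keeps the length. *)
Lemma lebesgue_measure_reflect (R : realType) (a : R) (A : set R) :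
  measurable A ->
  pushforward lebesgue_measure
    ((fun x : R => a - x) : measurableTypeR R -> measurableTypeR R) A =
  lebesgue_measure A.
Proof.
have mphi : measurable_fun setT
    ((fun x : R => a - x) : measurableTypeR R -> measurableTypeR R).
  exact: measurable_funB.
move=> mA; apply/esym.
pose mu : {measure set (measurableTypeR R) -> \bar R} :=
  measure_function_pushforward__canonical__measure_function_Measure lebesgue_measure mphi.
apply: (@lebesgue_measure_unique R mu) => // _ [[u v]] _ <-.
rewrite /mu /= /pushforward.
have -> : ((fun x : R => a - x) @^-1` `]u, v] = `[a - v, a - u[)%classic.
  by apply/seteqP; split=> x /=; rewrite !in_itv/=; lra.
rewrite !lebesgue_measure_itv/= !lte_fin ltrD2l ltrN2.
by case: ifP => // _; rewrite -!EFinD; congr (_%:E); lra.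
Qed.

Lemma ge0_integral_reflect (R : realType) (a : R) (F : R -> \bar R) :
  measurable_fun setT F -> (forall t, 0 <= F t)%E ->
  (\int[@lebesgue_measure R]_x F (a - x)%R =
   \int[@lebesgue_measure R]_x F x)%E.
Proof.
move=> mF F0.
have mphi : measurable_fun setT
    ((fun x : R => a - x) : measurableTypeR R -> measurableTypeR R).
  exact: measurable_funB.
have := @ge0_integral_pushforward _ _ _ _ R _ mphi lebesgue_measure
  setT F measurableT mF.
rewrite preimage_setT /comp => <-; last by [].
apply: eq_measure_integral => A mA _.
by apply: lebesgue_measure_reflect.
Qed.

Lemma vsub_cons (R : realType) (n : nat) (x y : R) (t u : n.-tuple R) :
  vsub (cons_tuple x t) (cons_tuple y u) = cons_tuple (x - y) (vsub t u).
Proof.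
apply: eq_from_tnth => i; rewrite tnth_mktuple.
case: (unliftP ord0 i) => [j|] -> //; rewrite !tnthS.
by rewrite tnth_mktuple.
Qed.

Lemma measurable_vsubr (R : realType) (n : nat) (a : n.-tuple R) :
  measurable_fun setT (fun t : n.-tuple R => vsub a t).
Proof.
apply/measurable_fun_tnthP => i.
rewrite (_ : _ \o _ = fun t => tnth a i - tnth t i); last first.
  by apply/funext => t /=; rewrite tnth_mktuple.
by apply: measurable_funB => //; exact: measurable_tnth.
Qed.

Lemma measurable_vsubl (R : realType) (n : nat) (a : n.-tuple R) :
  measurable_fun setT (fun t : n.-tuple R => vsub t a).
Proof.
apply/measurable_fun_tnthP => i.
rewrite (_ : _ \o _ = fun t => tnth t i - tnth a i); last first.
  by apply/funext => t /=; rewrite tnth_mktuple.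
by apply: measurable_funB => //; exact: measurable_tnth.
Qed.

Lemma eq_iint (R : realType) (n : nat) (F G : n.-tuple R -> \bar R) :
  F =1 G -> iint F = iint G.
Proof. by move/funext ->. Qed.

Lemma iint_reflect (R : realType) (n : nat) (a : n.-tuple R)
    (F : n.-tuple R -> \bar R) :
  measurable_fun setT F -> (forall t, 0 <= F t)%E ->
  iint (fun t => F (vsub a t)) = iint F.
Proof.
elim: n a F => [|n IH] a F mF F0 /=; first by rewrite [vsub _ _]tuple0.
case/tupleP: a => x a.
rewrite -[RHS](@ge0_integral_reflect R x); last 2 first.
- exact: (measurable_iint_cons mF F0).
- by move=> y; apply: iint_ge0.
apply: eq_integral => y _.
rewrite -[RHS](IH a); last 2 first.
- exact: (measurable_cons_section (x - y) mF).
- by [].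
by apply: eq_iint => t; rewrite vsub_cons.
Qed.

(** A translation is a composition of two reflections: substituting [vsub a t] for [t] turns
    [vsub t a] into the reflection of [t] in the origin. *)
Lemma iint_translate (R : realType) (n : nat) (a : n.-tuple R)
    (F : n.-tuple R -> \bar R) :
  measurable_fun setT F -> (forall t, 0 <= F t)%E ->
  iint (fun t => F (vsub t a)) = iint F.
Proof.
move=> mF F0; pose o := [tuple (0 : R) | i < n].
rewrite -(iint_reflect o mF F0) -[LHS](iint_reflect a); last 2 first.
- by apply: (measurableT_comp mF); exact: measurable_vsubl.
- by [].
apply: eq_iint => t; congr F; apply: eq_from_tnth => i.
rewrite !tnth_mktuple; ring.
Qed.

(** * Linearity of the signed integral *)

(** Under this condition the positive and negative parts in [Rint] both have finite integrals, so
    [fine] never falls back on its default value. *)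
Definition iintegrable (R : realType) (n : nat) (h : n.-tuple R -> R) : Prop :=
  measurable_fun setT h /\ (iint (fun t => `|h t|%:E) < +oo)%E.

Lemma measurable_maxr0 (R : realType) (n : nat) (h : n.-tuple R -> R) :
  measurable_fun setT h ->
  measurable_fun setT (fun t => (Num.max (h t) 0)%:E).
Proof. by move=> mh; apply/measurable_EFinP; exact: measurable_maxr. Qed.

Lemma iintegrable_fin_num (R : realType) (n : nat) (p h : n.-tuple R -> R) :
  measurable_fun setT p -> (forall t, 0 <= p t <= `|h t|) -> iintegrable h ->
  iint (fun t => (p t)%:E) \is a fin_num.
Proof.
move=> mp ph [mh hoo].
rewrite ge0_fin_numE; last first.
  by apply: iint_ge0 => t; rewrite lee_fin; case/andP: (ph t).
apply: le_lt_trans hoo; apply: le_iint => [|t||t].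
- exact/measurable_EFinP.
- by rewrite lee_fin; case/andP: (ph t).
- by apply/measurable_EFinP; exact: measurableT_comp.
- by rewrite lee_fin; case/andP: (ph t).
Qed.

(** Any splitting [h = p - q] into nonnegative integrable functions computes the integral: with [h+]
    and [h-] the two parts of [h], one has [h+ + q = h- + p] pointwise. All four integrals are
    finite, so the integrated identity can be rearranged. *)
Lemma Rint_subE (R : realType) (n : nat) (p q : n.-tuple R -> R) :
  measurable_fun setT p -> (forall t, 0 <= p t) ->
  measurable_fun setT q -> (forall t, 0 <= q t) ->
  (iint (fun t => (p t)%:E) < +oo)%E -> (iint (fun t => (q t)%:E) < +oo)%E ->
  fine (Defs.Rint (fun t => p t - q t)) =
  fine (iint (fun t => (p t)%:E)) - fine (iint (fun t => (q t)%:E)).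
Proof.
move=> mp p0 mq q0 poo qoo; set h := fun t => p t - q t.
have fp : iintegrable p.
  by split=> //; under eq_iint => t do rewrite ger0_norm ?p0//.
have fq : iintegrable q.
  by split=> //; under eq_iint => t do rewrite ger0_norm ?q0//.
have mh : measurable_fun setT h by exact: measurable_funB.
have mNh : measurable_fun setT (fun t => - h t) by exact: measurableT_comp.
have mP : measurable_fun setT (fun t => Num.max (h t) 0) by exact: measurable_maxr.
have mN : measurable_fun setT (fun t => Num.max (- h t) 0) by exact: measurable_maxr.
(* Since [p] and [q] are nonnegative, the positive part of [p - q] is at most [p] and the negative
   part at most [q]. *)
have P0 t : 0 <= Num.max (h t) 0 <= `|p t|.
  rewrite ger0_norm ?p0// /h; move: (p0 t) (q0 t).
  by rewrite le_max lexx orbT ge_max => *; lra.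
have N0 t : 0 <= Num.max (- h t) 0 <= `|q t|.
  rewrite ger0_norm ?q0// /h; move: (p0 t) (q0 t).
  by rewrite le_max lexx orbT ge_max => *; lra.
have : (iint (fun t => (Num.max (h t) 0)%:E) + iint (fun t => (q t)%:E) =
        iint (fun t => (Num.max (- h t) 0)%:E) + iint (fun t => (p t)%:E))%E.
  rewrite -!iintD//.
  all: try by [move=> t; rewrite lee_fin; case/andP: (P0 t)|
     move=> t; rewrite lee_fin; case/andP: (N0 t)|apply/measurable_EFinP].
  apply: eq_iint => t; rewrite -!EFinD; congr (_%:E); rewrite /h.
  by rewrite !maxEle; case: ifP; case: ifP; lra.
rewrite /Defs.Rint -/h.
move: (iintegrable_fin_num mP P0 fp) (iintegrable_fin_num mN N0 fq).
have pp t : 0 <= p t <= `|p t| by rewrite p0 ler_norm.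
have qq t : 0 <= q t <= `|q t| by rewrite q0 ler_norm.
move: (iintegrable_fin_num mp pp fp) (iintegrable_fin_num mq qq fq).
case: (iint _) => // a _; case: (iint _) => // b _.
case: (iint _) => // c _; case: (iint _) => // e _ /= [].
lra.
Qed.

Lemma iint_parts_lty (R : realType) (n : nat) (h : n.-tuple R -> R) :
  iintegrable h ->
  (iint (fun t => (Num.max (h t) 0)%:E) < +oo)%E /\
  (iint (fun t => (Num.max (- h t) 0)%:E) < +oo)%E.
Proof.
move=> fh; have [mh _] := fh.
have mNh : measurable_fun setT (fun t => - h t) by exact: measurableT_comp.
have mP : measurable_fun setT (fun t => Num.max (h t) 0).
  exact: measurable_maxr.
have mN : measurable_fun setT (fun t => Num.max (- h t) 0).
  exact: measurable_maxr.
split; rewrite ltey_eq; apply/orP; left; apply: (iintegrable_fin_num _ _ fh) => // t.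
- by rewrite le_max lexx orbT ge_max normr_ge0 ler_norm.
- by rewrite le_max lexx orbT ge_max normr_ge0 -normrN ler_norm.
Qed.

Lemma max0_subN (R : realType) (x : R) : Num.max x 0 - Num.max (- x) 0 = x.
Proof. by rewrite !maxEle; case: ifP; case: ifP; lra. Qed.

Lemma iintegrableZ (R : realType) (n : nat) (c : R) (h : n.-tuple R -> R) :
  iintegrable h -> iintegrable (fun t => c * h t).
Proof.
move=> [mh hoo]; split; first exact: measurable_funM.
under eq_iint => t do rewrite normrM EFinM.
rewrite iintZ//; first by rewrite lte_mul_pinfty.
by apply/measurable_EFinP; exact: measurableT_comp.
Qed.

Lemma iintegrableM_bounded (R : realType) (n : nat) (h k : n.-tuple R -> R) :
  iintegrable h -> measurable_fun setT k -> (forall t, `|k t| <= 1) ->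
  iintegrable (fun t => h t * k t).
Proof.
move=> [mh hoo] mk k1; split; first exact: measurable_funM.
apply: le_lt_trans hoo; apply: le_iint => [|t||t]; rewrite ?lee_fin//.
- apply/measurable_EFinP; apply: measurableT_comp => //.
  exact: measurable_funM.
- by apply/measurable_EFinP; exact: measurableT_comp.
- by rewrite normrM ler_piMr.
Qed.

(** The sum of the positive parts minus the sum of the negative parts is a splitting of [h + k], in
    general not the canonical one; [Rint_subE] makes this harmless. *)
Lemma fine_RintD (R : realType) (n : nat) (h k : n.-tuple R -> R) :
  iintegrable h -> iintegrable k ->
  fine (Defs.Rint (fun t => h t + k t)) =
  fine (Defs.Rint h) + fine (Defs.Rint k).
Proof.
move=> fh fk; have [mh _] := fh; have [mk _] := fk.
have [hP hN] := iint_parts_lty fh; have [kP kN] := iint_parts_lty fk.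
have mNh : measurable_fun setT (fun t => - h t) by exact: measurableT_comp.
have mNk : measurable_fun setT (fun t => - k t) by exact: measurableT_comp.
have max_ge0 (x : R) : 0 <= Num.max x 0 by rewrite le_max lexx orbT.
have mmax (u : n.-tuple R -> R) : measurable_fun setT u ->
    measurable_fun setT (fun t => Num.max (u t) 0).
  by move=> mu; exact: measurable_maxr.
have split_fine (u : n.-tuple R -> R) : measurable_fun setT u ->
    (iint (fun t => (Num.max (u t) 0)%:E) < +oo)%E ->
    iint (fun t => (Num.max (u t) 0)%:E) \is a fin_num.
  move=> mu; rewrite ge0_fin_numE//; apply: iint_ge0 => t.
  by rewrite lee_fin.
have iD (u v : n.-tuple R -> R) : measurable_fun setT u ->
    measurable_fun setT v ->
    iint (fun t => (Num.max (u t) 0 + Num.max (v t) 0)%:E) =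
    (iint (fun t => (Num.max (u t) 0)%:E) +
     iint (fun t => (Num.max (v t) 0)%:E))%E.
  move=> mu mv; rewrite -iintD//; try by move=> t; rewrite lee_fin.
  - exact: measurable_maxr0.
  - exact: measurable_maxr0.
have -> : (fun t => h t + k t) =
    (fun t => (Num.max (h t) 0 + Num.max (k t) 0) -
              (Num.max (- h t) 0 + Num.max (- k t) 0)).
  by apply/funext => t; rewrite opprD addrACA !max0_subN.
rewrite Rint_subE//.
- rewrite !iD// /Defs.Rint.
  move: (split_fine _ mh hP) (split_fine _ mNh hN).
  move: (split_fine _ mk kP) (split_fine _ mNk kN).
  case: (iint _) => // a _; case: (iint _) => // b _.
  case: (iint _) => // c _; case: (iint _) => // e _ /=.
  lra.
- by apply: measurable_funD; exact: mmax.
- by move=> t; rewrite addr_ge0.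
- by apply: measurable_funD; exact: mmax.
- by move=> t; rewrite addr_ge0.
- by rewrite iD// lte_add_pinfty.
- by rewrite iD// lte_add_pinfty.
Qed.

Lemma fine_RintZ (R : realType) (n : nat) (c : R) (h : n.-tuple R -> R) :
  iintegrable h ->
  fine (Defs.Rint (fun t => c * h t)) = c * fine (Defs.Rint h).
Proof.
move=> fh; have [mh _] := fh; have [hP hN] := iint_parts_lty fh.
have mNh : measurable_fun setT (fun t => - h t) by exact: measurableT_comp.
have max_ge0 (x : R) : 0 <= Num.max x 0 by rewrite le_max lexx orbT.
have iZ (u : n.-tuple R -> R) a : 0 <= a -> measurable_fun setT u ->
    iint (fun t => (a * Num.max (u t) 0)%:E) =
    (a%:E * iint (fun t => (Num.max (u t) 0)%:E))%E.
  move=> a0 mu; rewrite -iintZ//; last by move=> t; rewrite lee_fin.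
  exact: measurable_maxr0.
have fin (u : n.-tuple R -> R) :
    (iint (fun t => (Num.max (u t) 0)%:E) < +oo)%E ->
    iint (fun t => (Num.max (u t) 0)%:E) \is a fin_num.
  rewrite ge0_fin_numE//; apply: iint_ge0 => t.
  by rewrite lee_fin.
have mM (u : n.-tuple R -> R) a : measurable_fun setT u ->
    measurable_fun setT (fun t => a * Num.max (u t) 0).
  by move=> mu; apply: measurable_funM => //; exact: measurable_maxr.
have [c0|c0] := leP 0 c.
  have -> : (fun t => c * h t) =
      (fun t => c * Num.max (h t) 0 - c * Num.max (- h t) 0).
    by apply/funext => t; rewrite -mulrBr max0_subN.
  rewrite Rint_subE//; try by move=> t; rewrite mulr_ge0.
  - rewrite !iZ// /Defs.Rint.
    move: (fin _ hP) (fin _ hN).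
    by case: (iint _) => // a _; case: (iint _) => // b _ /=; rewrite mulrBr.
  - exact: mM.
  - exact: mM.
  - by rewrite iZ// lte_mul_pinfty.
  - by rewrite iZ// lte_mul_pinfty.
(* For negative [c] the positive and negative parts of [h] exchange roles, with the weight [- c]. *)
have Nc0 : 0 <= - c by lra.
have -> : (fun t => c * h t) =
    (fun t => - c * Num.max (- h t) 0 - - c * Num.max (h t) 0).
  by apply/funext => t; rewrite -mulrBr -[in LHS](max0_subN (h t)); ring.
rewrite Rint_subE//; try by move=> t; rewrite mulr_ge0.
- rewrite !iZ// /Defs.Rint.
  move: (fin _ hP) (fin _ hN).
  by case: (iint _) => // a _; case: (iint _) => // b _ /=; ring.
- exact: mM.
- exact: mM.
- by rewrite iZ// lte_mul_pinfty.
- by rewrite iZ// lte_mul_pinfty.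
Qed.

Lemma Rint_reflect (R : realType) (n : nat) (a : n.-tuple R)
    (h : n.-tuple R -> R) :
  measurable_fun setT h ->
  Defs.Rint (fun t => h (vsub a t)) = Defs.Rint h.
Proof.
move=> mh; have mNh : measurable_fun setT (fun t => - h t).
  exact: measurableT_comp.
rewrite /Defs.Rint (iint_reflect a (measurable_maxr0 mh)); last first.
  by move=> t; rewrite lee_fin le_max lexx orbT.
rewrite (iint_reflect a (measurable_maxr0 mNh))// => t.
by rewrite lee_fin le_max lexx orbT.
Qed.

(** * Square-integrable functions *)

(** The crude bound [|f g| <= f^2 + g^2] is enough. *)
Lemma L2R_mul_iintegrable (R : realType) (n : nat) (f g : n.-tuple R -> R) :
  L2R f -> L2R g -> iintegrable (fun t => f t * g t).
Proof.
move=> [mf foo] [mg goo]; split; first exact: measurable_funM.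
have mf2 : measurable_fun setT (fun t => (f t ^+ 2)%:E).
  by apply/measurable_EFinP; exact: measurable_funX.
have mg2 : measurable_fun setT (fun t => (g t ^+ 2)%:E).
  by apply/measurable_EFinP; exact: measurable_funX.
apply: (@le_lt_trans _ _
          (iint (fun t => (f t ^+ 2)%:E + (g t ^+ 2)%:E)%E)).
  apply: le_iint => [|t||t]; rewrite ?lee_fin//.
  - apply/measurable_EFinP; apply: measurableT_comp => //.
    exact: measurable_funM.
  - exact: emeasurable_funD.
  - rewrite -[f t ^+ 2]real_normK ?num_real// -[g t ^+ 2]real_normK ?num_real//.
    by rewrite normrM; nra.
rewrite iintD//; try by move=> t; rewrite lee_fin sqr_ge0.
by rewrite lte_add_pinfty.
Qed.

Lemma L2R_reflect (R : realType) (n : nat) (a : n.-tuple R)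
    (g : n.-tuple R -> R) :
  L2R g -> L2R (fun t => g (vsub a t)).
Proof.
move=> [mg goo]; split.
  by apply: (measurableT_comp mg); exact: measurable_vsubr.
rewrite (iint_reflect a (F := fun t => (g t ^+ 2)%:E))//.
- by apply/measurable_EFinP; exact: measurable_funX.
- by move=> t; rewrite lee_fin sqr_ge0.
Qed.

Lemma L2R_translate (R : realType) (n : nat) (a : n.-tuple R)
    (g : n.-tuple R -> R) :
  L2R g -> L2R (fun t => g (vsub t a)).
Proof.
move=> [mg goo]; split.
  by apply: (measurableT_comp mg); exact: measurable_vsubl.
rewrite (iint_translate a (F := fun t => (g t ^+ 2)%:E))//.
- by apply/measurable_EFinP; exact: measurable_funX.
- by move=> t; rewrite lee_fin sqr_ge0.
Qed.

Lemma L2R_mul_bounded (R : realType) (n : nat) (f k : n.-tuple R -> R) (c : R) :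
  L2R f -> measurable_fun setT k -> (forall t, `|k t| <= c) ->
  L2R (fun t => f t * k t).
Proof.
move=> [mf foo] mk kc; split; first exact: measurable_funM.
have mf2 : measurable_fun setT (fun t => (f t ^+ 2)%:E).
  by apply/measurable_EFinP; exact: measurable_funX.
apply: (@le_lt_trans _ _ (iint (fun t => (c ^+ 2)%:E * (f t ^+ 2)%:E)%E)).
  apply: le_iint => [|t||t]; rewrite ?lee_fin ?sqr_ge0//.
  - by apply/measurable_EFinP; apply: measurable_funX; exact: measurable_funM.
  - exact: measurable_funeM.
  - rewrite exprMn mulrC ler_wpM2r ?sqr_ge0//.
    by rewrite -[k t ^+ 2]real_normK ?num_real// lerXn2r ?nnegrE// (le_trans _ (kc t)).
rewrite iintZ ?sqr_ge0//; last by move=> t; rewrite lee_fin sqr_ge0.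
by rewrite lte_mul_pinfty ?lee_fin ?sqr_ge0.
Qed.

(** * The short-time Fourier transform under reflection *)

Lemma measurable_vdot (R : realType) (n : nat) (w : n.-tuple R) :
  measurable_fun setT (fun t : n.-tuple R => 2 * pi * vdot w t).
Proof.
apply: measurable_funM => //; apply: measurable_sum => i.
by apply: measurable_funM => //; exact: measurable_tnth.
Qed.

Lemma measurable_cos_vdot (R : realType) (n : nat) (w : n.-tuple R) :
  measurable_fun setT (fun t : n.-tuple R => cos (2 * pi * vdot w t)).
Proof.
apply: (@measurableT_comp _ _ _ _ _ _ (@cos R)); last exact: measurable_vdot.
by apply: continuous_measurable_fun; exact: continuous_cos.
Qed.

Lemma measurable_sin_vdot (R : realType) (n : nat) (w : n.-tuple R) :
  measurable_fun setT (fun t : n.-tuple R => sin (2 * pi * vdot w t)).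
Proof.
apply: (@measurableT_comp _ _ _ _ _ _ (@sin R)); last exact: measurable_vdot.
by apply: continuous_measurable_fun; exact: continuous_sin.
Qed.

Lemma vdot_vsub (R : realType) (n : nat) (w x t : n.-tuple R) :
  vdot w (vsub x t) = vdot w x - vdot w t.
Proof.
rewrite /vdot -sumrB; apply: eq_bigr => i _.
by rewrite tnth_mktuple mulrBr.
Qed.

(** After the substitution of [x - t] for [t], the transform of [f2] at [(x, w)] becomes
    [e^{-2 pi i w.x}] times the complex conjugate of that of [f1]: the integrands are real, and the
    sign of [t] in the exponential has flipped. Neither the phase nor the conjugation changes the
    modulus. *)
Lemma norm_stft_reflect (R : realType) (n : nat) (g f1 f2 : n.-tuple R -> R)
    (x w : n.-tuple R) :
  L2R g -> L2R f1 -> L2R f2 ->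
  (forall t, f2 (vsub x t) * g (vsub (vsub x t) x) = f1 t * g (vsub t x)) ->
  `|stft g f1 x w| = `|stft g f2 x w|.
Proof.
move=> g2 f12 f22 f2E; set th := 2 * pi * vdot w x.
pose h f t := f t * g (vsub t x).
have fin_h f : L2R f -> iintegrable (h f).
  by move=> f_2; apply: L2R_mul_iintegrable => //; exact: L2R_translate.
have [mc ms] := (measurable_cos_vdot w, measurable_sin_vdot w).
have c1 (y : R) : `|cos y| <= 1 by rewrite ler_norml cos_geN1 cos_le1.
have s1 (y : R) : `|sin y| <= 1 by rewrite ler_norml sin_geN1 sin_le1.
have hc f : L2R f -> iintegrable (fun t => h f t * cos (2 * pi * vdot w t)).
  by move=> /fin_h fh; apply: iintegrableM_bounded.
have hs f : L2R f -> iintegrable (fun t => h f t * sin (2 * pi * vdot w t)).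
  by move=> /fin_h fh; apply: iintegrableM_bounded.
have [mh2c _] := hc _ f22; have [mh2s _] := hs _ f22.
rewrite !normc_def /stft /=; congr (_%:C)%C; congr Num.sqrt.
(* Only the two integrals of [f2] are reflected; the subtraction formulas for cosine and sine with
   angle [th] then express them through [C1] and [S1]. *)
rewrite -(Rint_reflect x mh2c) -(Rint_reflect x mh2s).
set C1 := fine (Defs.Rint (fun t => f1 t * _ * cos _)).
set S1 := fine (Defs.Rint (fun t => f1 t * _ * sin _)).
have argE t : 2 * pi * vdot w (vsub x t) = th - 2 * pi * vdot w t.
  by rewrite vdot_vsub mulrBr.
have -> : (fun t => h f2 (vsub x t) * cos (2 * pi * vdot w (vsub x t))) =
    (fun t => cos th * (h f1 t * cos (2 * pi * vdot w t)) +
              sin th * (h f1 t * sin (2 * pi * vdot w t))).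
  by apply/funext => t; rewrite /h f2E argE cosB; ring.
have -> : (fun t => h f2 (vsub x t) * sin (2 * pi * vdot w (vsub x t))) =
    (fun t => sin th * (h f1 t * cos (2 * pi * vdot w t)) +
              - cos th * (h f1 t * sin (2 * pi * vdot w t))).
  by apply/funext => t; rewrite /h f2E argE sinB; ring.
rewrite !fine_RintD; try by apply: iintegrableZ; [exact: hc|exact: hs].
all: try by apply: iintegrableZ; exact: hc.
all: try by apply: iintegrableZ; exact: hs.
rewrite !fine_RintZ; try exact: hc.
all: try exact: hs.
rewrite -/C1 -/S1.
have := cos2Dsin2 th.
set c := cos th; set s := sin th => cs.
(* The pair for [f2] is the image of [(C1, S1)] under an orthogonal matrix with entries [c] and [s]
   up to sign, so the sum of squares is multiplied by [c ^+ 2 + s ^+ 2 = 1]. *)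
transitivity ((c ^+ 2 + s ^+ 2) * (C1 ^+ 2 + S1 ^+ 2)); last by ring.
by rewrite cs; ring.
Qed.

(** * The odd periodic sawtooth *)

(* saw y = frac y - frac (- y), where frac y = y - floor y. *)
Definition saw (R : realType) (y : R) : R :=
  y *+ 2 - (Num.floor y)%:~R + (Num.floor (- y))%:~R.

(** Fractional parts ignore the integer [m], so replacing [y] by [m - y] swaps the two of them. *)
Lemma saw_intB (R : realType) (m : int) (y : R) : saw (m%:~R - y) = - saw y.
Proof.
rewrite /saw opprB [y - _]addrC floorDzr ?intr_int// floorDzr ?rpredN ?intr_int//.
rewrite -[- m%:~R]mulrNz !intrKfloor !intrD mulrNz; ring.
Qed.

Lemma norm_saw_le1 (R : realType) (y : R) : `|saw y| <= 1.
Proof.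
rewrite /saw ler_norml.
move: (floor_itv y) (floor_itv (- y)); rewrite !intrD => /andP[a b] /andP[c e].
by apply/andP; split; lra.
Qed.

Lemma measurable_saw (R : realType) : measurable_fun setT (@saw R).
Proof.
have mfl : measurable_fun setT (fun y : R => (Num.floor y)%:~R : R).
  apply: nondecreasing_measurable => // x y xy.
  by rewrite ler_int; exact: le_floor.
apply: measurable_funD.
  by apply: measurable_funB => //; apply: measurable_funD.
exact: (measurableT_comp mfl (measurable_funN (@measurable_id _ R setT))).
Qed.

Lemma saw_neq0_ae (R : realType) (N : R) : N != 0 ->
  {ae @lebesgue_measure R, forall x, saw (N * x) != 0}.
Proof.
move=> N0.
pose D := range (fun z : int => z%:~R / 2 / N : R).
have cD : countable D.
  exact: sub_countable (card_image_le _ _) (countableP _).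
have : {ae @lebesgue_measure R, forall x, ~ D x}.
  exists D; split.
  - apply: countable_measurable => //.
  - exact: countable_lebesgue_measure0.
  - by move=> x /= /contrapT.
apply: ae_lebesgueS => x; apply: contra_not_neq => saw0.
(* When the sawtooth vanishes at [N * x], this integer equals [2 N x]; hence all zeros lie in the
   countable set [D] of half-integers divided by [N]. *)
exists (Num.floor (N * x) - Num.floor (- (N * x))) => //=.
have -> : (Num.floor (N * x) - Num.floor (- (N * x)))%:~R = (N * x) *+ 2.
  by move: saw0; rewrite /saw intrB => ?; lra.
by field.
Qed.

Lemma iint_saw_eq0 (R : realType) (n : nat) (N : R) (g : n.+1.-tuple R -> R) :
  N != 0 -> measurable_fun setT g ->
  iint (fun t => ((saw (N * tnth t ord0) * g t) ^+ 2)%:E) = 0%E ->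
  iint (fun t => (g t ^+ 2)%:E) = 0%E.
Proof.
move=> N0 mg.
have mG : measurable_fun setT (fun t => (g t ^+ 2)%:E).
  by apply/measurable_EFinP; exact: measurable_funX.
have mF : measurable_fun setT
    (fun t : n.+1.-tuple R => ((saw (N * tnth t ord0) * g t) ^+ 2)%:E).
  apply/measurable_EFinP/measurable_funX/measurable_funM => //.
  apply: (measurableT_comp (@measurable_saw R)).
  by apply: measurable_funM => //; exact: measurable_tnth.
have F0 (t : n.+1.-tuple R) : (0 <= ((saw (N * tnth t ord0) * g t) ^+ 2)%:E)%E.
  by rewrite lee_fin sqr_ge0.
have G0 t : (0 <= (g t ^+ 2)%:E)%E by rewrite lee_fin sqr_ge0.
move=> /= /ge0_integral_eq0P aeF; apply/ge0_integral_eq0P.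
- exact: measurable_iint_cons mG G0.
- by move=> x; exact: iint_ge0.
have {}aeF := aeF (measurable_iint_cons mF F0) (fun x => iint_ge0 (fun t => F0 _)).
apply: (ae_lebesgueS2 _ aeF (saw_neq0_ae N0)) => x Fx sx.
apply: iint_eq0_sub Fx => //.
- exact: (measurable_cons_section x mF).
- exact: (measurable_cons_section x mG).
move=> t; rewrite tnth0 => -[] /eqP; rewrite sqrf_eq0 mulf_eq0 (negbTE sx) /=.
by move=> /eqP ->; rewrite expr0n.
Qed.

(** * Tools for a window that vanishes almost everywhere *)

(** The unit cube has volume 1; its indicator provides a square-integrable function of nonzero
    norm. *)
Lemma iint_prod_indic01 (R : realType) (n : nat) :
  iint (fun t : n.-tuple R =>
    (\prod_(i < n) (\1_(`[0%R, 1%R]%classic) (tnth t i) : R))%:E) = 1%E.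
Proof.
elim: n => [|n IH] /=; first by rewrite big_ord0.
transitivity (\int[@lebesgue_measure R]_x (\1_(`[0%R, 1%R]%classic) x)%:E)%E.
  apply: eq_integral => x _.
  rewrite -[RHS]mule1 -{}IH -iintZ.
  - by apply: eq_iint => t; rewrite big_ord_recl tnth0 EFinM;
      under eq_bigr do rewrite tnthS.
  - by rewrite indicE.
  - apply/measurable_EFinP; apply: measurable_prod => i _.
    apply: (measurableT_comp (measurable_indic _)) => //.
    exact: measurable_tnth.
  - by move=> t; rewrite lee_fin; apply: prodr_ge0 => i _; rewrite indicE.
transitivity (lebesgue_measure (`[0%R, 1%R]%classic : set R)).
  by rewrite integral_indic// setIT.
by rewrite lebesgue_measure_itv/= lte_fin ltr01 oppr0 adde0.
Qed.

(** The translated window still has zero norm, and each integrand vanishes wherever that window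
    does, so [iint_eq0_sub] kills its positive and negative parts. *)
Lemma stft_window_eq0 (R : realType) (n : nat) (g f : n.-tuple R -> R)
    (x w : n.-tuple R) :
  measurable_fun setT g -> measurable_fun setT f ->
  iint (fun t => (g t ^+ 2)%:E) = 0%E -> stft g f x w = 0.
Proof.
move=> mg mf ig.
have mG : measurable_fun setT (fun t => (g t ^+ 2)%:E).
  by apply/measurable_EFinP; exact: measurable_funX.
have G0 t : (0 <= (g t ^+ 2)%:E)%E by rewrite lee_fin sqr_ge0.
have mgx : measurable_fun setT (fun t => g (vsub t x)).
  by apply: (measurableT_comp mg); exact: measurable_vsubl.
have igx : iint (fun t => (g (vsub t x) ^+ 2)%:E) = 0%E.
  by rewrite (iint_translate x mG G0).
have part0 (k : n.-tuple R -> R) : measurable_fun setT k ->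
    (forall t, g (vsub t x) = 0 -> k t = 0) ->
    iint (fun t => (Num.max (k t) 0)%:E) = 0%E.
  move=> mk k0; apply: iint_eq0_sub igx.
  - by apply/measurable_EFinP; exact: measurable_funX.
  - by move=> t; rewrite lee_fin sqr_ge0.
  - exact: measurable_maxr0.
  - by move=> t; rewrite lee_fin le_max lexx orbT.
  - by move=> t [] /eqP; rewrite sqrf_eq0 => /eqP /k0 ->; rewrite maxxx.
have Rint0 (k : n.-tuple R -> R) : measurable_fun setT k ->
    Defs.Rint (fun t => f t * g (vsub t x) * k t) = 0%E.
  move=> mk; have mh : measurable_fun setT (fun t => f t * g (vsub t x) * k t).
    by apply: measurable_funM => //; exact: measurable_funM.
  rewrite /Defs.Rint !part0 ?sube0//.
  - exact: measurableT_comp.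
  - by move=> t ->; rewrite mulr0 mul0r oppr0.
  - by move=> t ->; rewrite mulr0 mul0r.
rewrite /stft !Rint0 ?oppr0//.
- exact: measurable_sin_vdot.
- exact: measurable_cos_vdot.
Qed.

(** * Common denominators and unimodular factors *)

(** The product of the denominators in one row of [L] clears that coordinate for all lattice points
    at once, so [N] is chosen before [k]. *)
Lemma latx_common_denom (R : realType) (d : nat) (L : 'M[rat]_(d + d))
    (i : 'I_d) :
  exists2 N : int, N != 0 & forall k : 'cV[int]_(d + d),
    exists m : int, N%:~R * tnth (latx R L k) i = m%:~R.
Proof.
exists (\prod_j denq (L (lshift d i) j)).
  by apply/prodf_neq0 => j _; rewrite denq_neq0.
move=> k; rewrite tnth_mktuple mxE big_distrr/=.
(* Multiplying the [j]-th entry by the full product cancels its own denominator and leaves the other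
   denominators times its numerator. *)
pose a j := (\prod_(j' | j' != j) denq (L (lshift d i) j')) *
  numq (L (lshift d i) j) * k j 0.
exists (\sum_j a j); rewrite rmorph_sum; apply: eq_bigr => j _ /=.
rewrite !mxE (bigD1 j)//= /a !intrM !mulrA; congr (_ * _).
by rewrite /ratr; field; rewrite intr_eq0 denq_neq0.
Qed.

(** With [nu = a + i b], the integrand is [(f1 - a f2)^2 + (b f2)^2]. Where it vanishes, [f1 = a f2]
    and [b f2 = 0], hence [f1^2 = (a^2 + b^2) f2^2 = f2^2]. The function [h] carries whatever
    consequence of this equality is wanted. *)
Lemma phase_mul_eq0 (R : realType) (n : nat) (f1 f2 h : n.-tuple R -> R)
    (nu : R[i]) :
  `|nu| = 1 -> measurable_fun setT f1 -> measurable_fun setT f2 ->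
  measurable_fun setT h -> (forall t, f1 t ^+ 2 = f2 t ^+ 2 -> h t = 0) ->
  iint (fun t => (ComplexField.Normc.normc
    ((f1 t)%:C - nu * (f2 t)%:C)%C ^+ 2)%:E) = 0%E ->
  iint (fun t => (h t ^+ 2)%:E) = 0%E.
Proof.
case: nu => a b nu1 mf1 mf2 mh h0.
have ab1 : a ^+ 2 + b ^+ 2 = 1.
  move: nu1; rewrite normc_def /= => -[] /(congr1 (fun x => x ^+ 2)).
  by rewrite expr1n sqr_sqrtr// addr_ge0 ?sqr_ge0.
pose k t := (f1 t - a * f2 t) ^+ 2 + (b * f2 t) ^+ 2.
have kE t : ComplexField.Normc.normc
    ((f1 t)%:C - (a +i* b) * (f2 t)%:C)%C ^+ 2 = k t.
  rewrite /ComplexField.Normc.normc /k /=.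
  by rewrite sqr_sqrtr ?addr_ge0 ?sqr_ge0//; ring.
under eq_iint do rewrite kE.
apply: iint_eq0_sub => [|t||t|t].
- apply/measurable_EFinP; apply: measurable_funD; apply: measurable_funX.
    by apply: measurable_funB => //; exact: measurable_funM.
  exact: measurable_funM.
- by rewrite lee_fin addr_ge0 ?sqr_ge0.
- by apply/measurable_EFinP; exact: measurable_funX.
- by rewrite lee_fin sqr_ge0.
- move=> [] /eqP; rewrite paddr_eq0 ?sqr_ge0// !sqrf_eq0 subr_eq0.
  move=> /andP[/eqP f1E /eqP bf2]; rewrite h0 ?expr0n//.
  by rewrite f1E -[RHS]mul1r -ab1 mulrDl -!exprMn bf2 expr0n addr0.
Qed.

(** * Construction of the two functions *)

Unset Implicit Arguments.

Theorem theorem1p6 (R : realType) (d : nat) (L : 'M[rat]_(d + d)) :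
  (0 < d)%N -> L \in unitmx ->
  forall g : d.-tuple R -> R, L2R g ->
  exists f1 f2 : d.-tuple R -> R,
    [/\ L2R f1, L2R f2,
      (forall k : 'cV[int]_(d + d),
         `|stft g f1 (latx R L k) (latw R L k)|
         = `|stft g f2 (latx R L k) (latw R L k)|) &
      ~ (exists nu : R[i], `|nu| = 1 /\
           iint (fun t : d.-tuple R =>
             (ComplexField.Normc.normc ((f1 t)%:C - nu * (f2 t)%:C)%C ^+ 2)%:E) = 0%E)].
Proof.
case: d L => // n L _ _ g g2; have [mg _] := g2.
pose o := [tuple (0 : R) | i < n.+1].
(* The sawtooth will see only the coordinate [ord0], so one row of [L] supplies the denominator. *)
have [N N0 latN] := latx_common_denom R L ord0.
have NR0 : (N%:~R : R) != 0 by rewrite intr_eq0.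
have [ig|ig] := eqVneq (iint (fun t => (g t ^+ 2)%:E)) 0%E.
  pose f (t : n.+1.-tuple R) : R :=
    \prod_(i < n.+1) \1_(`[0%R, 1%R]%classic) (tnth t i).
  have mf : measurable_fun setT f.
    apply: measurable_prod => i _.
    apply: (measurableT_comp (measurable_indic _)) => //.
    exact: measurable_tnth.
  have ff t : f t ^+ 2 = f t.
    rewrite /f -prodrXl; apply: eq_bigr => i _.
    by rewrite indicE; case: (_ \in _); rewrite ?expr1n ?expr0n.
  have if1 : iint (fun t => (f t ^+ 2)%:E) = 1%E.
    under eq_iint do rewrite ff.
    exact: iint_prod_indic01.
  exists f, (fun=> 0); split.
  - by split=> //; rewrite if1 ltry.
  - split=> //; rewrite (_ : iint _ = 0%E) ?ltry//.
    (* The integral of the zero function is compared with that of [g ^+ 2], which vanishes in this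
       case. *)
    apply: iint_eq0_sub ig => [|t||t|t _].
    + by apply/measurable_EFinP; exact: measurable_funX.
    + by rewrite lee_fin sqr_ge0.
    + by apply/measurable_EFinP; exact: measurable_funX.
    + by rewrite lee_fin sqr_ge0.
    + by rewrite expr0n.
  - by move=> k; rewrite !stft_window_eq0.
  - move=> [nu [nu1 inu]]; have := oner_neq0 R.
    have : iint (fun t => (f t ^+ 2)%:E) = 0%E.
      (* Here the second function is zero, so equality of squares forces [f t = 0], against
         [if1]. *)
      apply: (phase_mul_eq0 nu1 mf _ mf _ inu) => // t.
      by rewrite expr0n => /eqP; rewrite sqrf_eq0 => /eqP.
    by rewrite if1 => -[] ->; rewrite eqxx.
pose gN t := g (vsub o t).
have gN2 : L2R gN := L2R_reflect o g2; have [mgN _] := gN2.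
pose s (t : n.+1.-tuple R) := saw (N%:~R * tnth t ord0).
have ms : measurable_fun setT s.
  apply: (measurableT_comp (@measurable_saw R)).
  by apply: measurable_funM => //; exact: measurable_tnth.
have s1 t : `|s t| <= 1 := norm_saw_le1 _.
pose f1 t := gN t * (1 + s t); pose f2 t := gN t * (1 - s t).
have f12 : L2R f1.
  (* The constant comes from [|1 + s| <= 1 + |s| <= 2]; the same bound serves for [1 - s] below. *)
  apply: (L2R_mul_bounded (c := 2)) => // [|t]; first exact: measurable_funD.
  by apply: le_trans (ler_normD _ _) _; rewrite normr1; move: (s1 t); lra.
have f22 : L2R f2.
  apply: (L2R_mul_bounded (c := 2)) => // [|t]; first exact: measurable_funB.
  by apply: le_trans (ler_normB _ _) _; rewrite normr1; move: (s1 t); lra.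
exists f1, f2; split=> // [k|[nu [nu1 inu]]].
  (* The reflection exchanges [g(-t)] with [g(t - x)] and changes the sign of [s], because [N] times
     the first coordinate of [x] is an integer; both products become [g(-t) g(t - x) (1 + s t)]. *)
  apply: norm_stft_reflect => // t; set x := latx R L k.
  have [m xm] := latN k.
  have sN : s (vsub x t) = - s t.
    by rewrite /s tnth_mktuple mulrBr xm saw_intB.
  have gNE : gN (vsub x t) = g (vsub t x).
    congr g; apply: eq_from_tnth => i; rewrite !tnth_mktuple; ring.
  have gE : g (vsub (vsub x t) x) = gN t.
    congr g; apply: eq_from_tnth => i; rewrite !tnth_mktuple; ring.
  by rewrite /f2 /f1 sN gNE gE; ring.
have [mf1 _] := f12; have [mf2 _] := f22.
have msg : measurable_fun setT (fun t => s t * gN t) by exact: measurable_funM.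
have isg : iint (fun t => ((s t * gN t) ^+ 2)%:E) = 0%E.
  apply: (phase_mul_eq0 nu1 mf1 mf2 msg _ inu) => t.
  rewrite /f1 /f2 !exprMn => /eqP; rewrite -subr_eq0.
  (* This is [f1^2 - f2^2], factored so that the vanishing of any nonconstant factor gives
     [s t * gN t = 0]. *)
  have -> : gN t ^+ 2 * (1 + s t) ^+ 2 - gN t ^+ 2 * (1 - s t) ^+ 2 =
            4 * (s t * gN t) * gN t by ring.
  rewrite !mulf_eq0 pnatr_eq0 /= => /orP[/orP[]|] /eqP ->.
  - by rewrite mul0r.
  - by rewrite mulr0.
  - by rewrite mulr0.
have := iint_saw_eq0 NR0 mgN isg.
(* Undoing the reflection turns the zero norm of [gN] into that of [g], which contradicts [ig]. *)
rewrite (iint_reflect o (F := fun t => (g t ^+ 2)%:E)).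
- exact/eqP.
- by apply/measurable_EFinP; exact: measurable_funX.
- by move=> t; rewrite lee_fin sqr_ge0.
Qed.
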